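(* For all integers $k\ge 2$ and $n\ge 3k-3$, we have $ar(\mathcal{O}_n,M_k)\le n+4k-9$.
   Context: A graph is outerplanar if it has a plane embedding in which all vertices lie on the boundary of the outer face; it is maximal outerplanar if no edge can be added while preserving outerplanarity. $\mathcal{O}_n$ denotes the class of all maximal outerplanar graphs on $n$ vertices. $M_k$ denotes a matching with $k$ edges. An edge-coloring is a map from the edge set to a set of colors; a subgraph is rainbow if its edges receive pairwise distinct colors. For a graph $H$ and a class $\mathcal{G}$ of graphs, $ar(\mathcal{G},H)$ denotes the maximum number of colors in an edge-coloring (using exactly that many colors) of some graph $G\in\mathcal{G}$ such that $G$ contains no rainbow copy of $H$ as a subgraph.
   Formalization: The formal theorem also assumes n ≥ 2k, which excludes only k = 2, n = 3; there the claim fails, since K_3 contains no M_2 and can be colored with 3 colors, while n+4k−9 = 2. *)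

(* Defs.v *)
From mathcomp Require Import all_boot all_order all_algebra.
From mathcomp Require Import all_classical all_reals all_analysis.
Set Implicit Arguments.
Unset Strict Implicit.
Unset Printing Implicit Defensive.
Import Order.TTheory GRing.Theory Num.Theory.
Import numFieldNormedType.Exports.

Local Open Scope classical_set_scope.

Record sgraph (T : finType) := SGraph {
  edges :> {set {set T}};
  card_edge : forall e, e \in edges -> #|e| = 2 }.

Section PlaneEmbedding.
Local Open Scope ring_scope.
Variables (R : realType) (T : finType).

Definition is_arc (a b : R * R) (A : set (R * R)) : Prop :=
  exists f : R -> R * R,
    [/\ {within `[0, 1], continuous f},
        {in `[0, 1] &, injective f},
        f 0 = a, f 1 = b & A = f @` `[0, 1]].

Definition arc_interior (pos : T -> R * R) (arc : {set T} -> set (R * R))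
    (e : {set T}) : set (R * R) :=
  arc e `\` pos @` [set` e].

(* Only the values of arc on edges of G are relevant. *)
Definition plane_embedding (G : sgraph T) (pos : T -> R * R)
    (arc : {set T} -> set (R * R)) : Prop :=
  [/\ injective pos,
      forall e, e \in G ->
        exists u v, e = [set u; v]%SET /\ is_arc (pos u) (pos v) (arc e),
      forall e, e \in G -> arc_interior pos arc e `&` range pos = set0 &
      forall e e', e \in G -> e' \in G -> e != e' ->
        arc_interior pos arc e `&` arc e' = set0].

Definition drawing (G : sgraph T) (pos : T -> R * R)
    (arc : {set T} -> set (R * R)) : set (R * R) :=
  range pos `|` \bigcup_(e in [set` edges G]) arc e.

Definition is_face (D F : set (R * R)) : Prop :=
  exists2 x, (~` D) x & F = connected_component (~` D) x.

Definition is_outer_face (D F : set (R * R)) : Prop :=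
  is_face D F /\ ~ bounded_set F.

Definition boundary (F : set (R * R)) : set (R * R) :=
  closure F `\` interior F.

Definition outerplanar (G : sgraph T) : Prop :=
  exists (pos : T -> R * R) (arc : {set T} -> set (R * R)) (F : set (R * R)),
    [/\ plane_embedding G pos arc,
        is_outer_face (drawing G pos arc) F &
        forall v, boundary F (pos v)].

Definition maximal_outerplanar (G : sgraph T) : Prop :=
  outerplanar G /\
  forall (G' : sgraph T) (e : {set T}),
    e \notin G -> edges G' = (e |: edges G)%SET -> ~ outerplanar G'.

End PlaneEmbedding.

Lemma matching_card_edge k (e : {set 'I_k * bool}) :
  e \in [set [set (i, false); (i, true)]%SET | i : 'I_k]%SET -> #|e| = 2.
Proof. by case/imsetP=> i _ ->; rewrite cards2 xpair_eqE eqxx. Qed.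

Definition matching (k : nat) : sgraph ('I_k * bool)%type :=
  SGraph (@matching_card_edge k).

(* A copy of H need not be induced; col only matters on edges of G. *)
Definition rainbow_copy (T U : finType) (C : Type) (G : sgraph T)
    (col : {set T} -> C) (H : sgraph U) : Prop :=
  exists h : U -> T,
    [/\ injective h,
        forall e, e \in H -> (h @: e)%SET \in G &
        {in H &, injective (fun e : {set U} => col (h @: e)%SET)}].

(* Surjectivity on 'I_c: exactly c colors are used. *)
Definition rainbow_free_colors (T U : finType) (cls : sgraph T -> Prop)
    (H : sgraph U) (c : nat) : Prop :=
  exists (G : sgraph T) (col : {set T} -> 'I_c),
    [/\ cls G, (col @: edges G)%SET = [set: 'I_c]%SET &
        ~ rainbow_copy G col H].

(* At most 'C(#|T|, 2) colors can be used on the edges of a graph on T, so the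
   range of the maximum is no restriction.  When H has more than #|T| vertices no
   copy of H exists and this is the largest number of edges in the class; for
   instance it is 3 for K_3 and the matching with two edges. *)
Definition anti_ramsey (T U : finType) (cls : sgraph T -> Prop)
    (H : sgraph U) : nat :=
  \max_(c < 'C(#|T|, 2).+1 | `[< rainbow_free_colors cls H c >]) c.

Definition mop (R : realType) (n : nat) : sgraph 'I_n -> Prop :=
  @maximal_outerplanar R 'I_n.
Arguments mop : clear implicits.

(* Main.v *)
(** Proof idea.  Fix one edge of each color; it is enough to show that an outerplanar
    graph on [n >= 2k] vertices with at least [n + 4k - 8] edges has [k] disjoint edges.

    Outerplanarity is used only through a parity argument in the style of Hanani and
    Tutte.  Let [w v e] be the parity of the crossings of an edge [e] with a ray issued
    from a vertex [v] off [e].  Moving [v] to infinity through the outer face shows that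
    [w v] is a coboundary, [w v xy = g v x + g v y], and looking at the difference of two
    disjoint arcs [ab] and [cd] as a map from a square to the punctured plane relates
    [w c ab], [w d ab], [w a cd] and [w b cd].  Together they yield a tournament [r] on
    the vertices (for points on a circle: the cyclic order cut open at a point) with
    [r a c + r a d + r b c + r b d = 0] for any two disjoint edges [ab] and [cd].

    From such an [r] one gets, by contracting edges, at most [2m - 3] edges on [m >= 2]
    vertices, and [sum_(b in B) (deg b - 1) <= 2 (|A| - 1)] for bipartite graphs.
    If a maximum matching [M] has [m] edges, its vertices span at most [4m - 3] edges.
    The other edges join a vertex of [M] to an unmatched one; as there is no augmenting
    path, the bipartite bound gives at most [n - 2] of them. *)

Require Import Defs.
From mathcomp Require Import all_boot all_order all_algebra.
From mathcomp Require Import zify lra.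

Set Implicit Arguments.
Unset Strict Implicit.
Unset Printing Implicit Defensive.

(** * Graphs without crossings with respect to a tournament *)

Section Noncrossing.
Variables (T : finType) (r : rel T).
Hypothesis rC : forall x y, x != y -> r y x = ~~ r x y.

(* When [r] is a cyclic order cut open at a point, this says that the chords [ab] and [cd]
   do not cross. *)
Definition uncrossed (a b c d : T) : bool :=
  ~~ (r a c (+) r a d (+) r b c (+) r b d).

Lemma uncrossed_sym a b c d :
  a != c -> a != d -> b != c -> b != d -> uncrossed a b c d = uncrossed c d a b.
Proof.
move=> ac ad bc bd; rewrite /uncrossed (rC ac) (rC ad) (rC bc) (rC bd).
by case: (r a c) (r a d) (r b c) (r b d) => [] [] [] [].
Qed.

Lemma uncrossedC a b c d : uncrossed a b c d = uncrossed b a c d.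
Proof.
by rewrite /uncrossed; case: (r a c) (r a d) (r b c) (r b d) => [] [] [] [].
Qed.

(** The contributions of [b] cancel modulo 2. Contractions rely on this: a contracted edge behaves
    like the path that it replaces. *)
Lemma uncrossed_trans a b b' c d :
  uncrossed a b c d -> uncrossed b b' c d -> uncrossed a b' c d.
Proof.
rewrite /uncrossed.
by case: (r a c) (r a d) (r b c) (r b d) (r b' c) (r b' d) => [] [] [] [] [] [].
Qed.

(* When [r] is a cyclic order cut open at a point, this is the same order cut open at [v]. *)
Definition rotate (v x y : T) : bool := r x y (+) r v x (+) r v y.

Lemma rotateC v x y : x != y -> rotate v y x = ~~ rotate v x y.
Proof.
by move=> /rC E; rewrite /rotate E; case: (r x y) (r v x) (r v y) => [] [] [].
Qed.

Lemma uncrossed_rotate v a c d :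
  uncrossed v a c d -> rotate v a c = rotate v a d.
Proof.
rewrite /uncrossed /rotate.
by case: (r v c) (r v d) (r a c) (r a d) (r v a) => [] [] [] [] [].
Qed.

(** Its size serves as a rank: [t] need not be transitive, so first and last elements are replaced
    by vertices of extremal outdegree. *)
Definition outset (t : rel T) (N : {set T}) (a : T) : {set T} :=
  [set c in N | (c != a) && t a c].

(** No third vertex of [N] tells [a] from [b], so the two outsets agree away from these two, and [b]
    gains [a]. *)
Lemma outset_proper (t : rel T) (N : {set T}) (a b : T) :
  (forall x y, x != y -> t y x = ~~ t x y) ->
  a \in N -> a != b -> t b a ->
  (forall c, c \in N -> c != a -> c != b -> t c a = t c b) ->
  #|outset t N a| < #|outset t N b|.
Proof.
move=> tC aN ab tba H; apply: proper_card; apply/properP; split; last first.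
  by exists a; rewrite !inE ?aN ?ab ?tba // eqxx andbF.
apply/subsetP => c; rewrite !inE => /and3P[cN ca tac]; rewrite cN /=.
have cb : c != b.
  by apply: contraTneq tac => ->; rewrite (tC b a) ?tba // eq_sym.
by rewrite cb /= (tC c b) // -(H c) // -(tC c a).
Qed.

(** * Edge bound by contraction *)

Section EdgeBound.

Definition ordered_edges (E : rel T) (A : {set T}) : nat :=
  \sum_(x in A) \sum_(y in A) E x y.

Definition degree_in (E : rel T) (A : {set T}) (x : T) : nat :=
  \sum_(y in A) E x y.

Lemma degree_inE (E : rel T) (A : {set T}) (x : T) :
  degree_in E A x = #|[set y in A | E x y]|.
Proof.
rewrite /degree_in -sum1_card big_mkcond [RHS]big_mkcond; apply: eq_bigr => y _.
by rewrite !inE; case: (y \in A); case: (E x y).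
Qed.

Lemma ordered_edges_rem (E : rel T) (A : {set T}) v :
  symmetric E -> irreflexive E -> v \in A ->
  ordered_edges E A = ordered_edges E (A :\ v) + 2 * degree_in E (A :\ v) v.
Proof.
move=> Es Ei vA; rewrite /ordered_edges (big_setD1 v) //= (big_setD1 v vA) /= Ei.
have -> : \sum_(i in A :\ v) \sum_(y in A) E i y =
  \sum_(i in A :\ v) (E v i + \sum_(y in A :\ v) E i y).
  by apply: eq_bigr => i _; rewrite (big_setD1 v) //= Es.
by rewrite big_split /= /degree_in; lia.
Qed.

Definition uncrossed_on (E : rel T) (A : {set T}) : Prop :=
  forall a b c d, a \in A -> b \in A -> c \in A -> d \in A ->
    [&& a != c, a != d, b != c & b != d] -> E a b -> E c d -> uncrossed a b c d.

(* For a cyclic order, [a] is the first neighbour after [v]. *)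
Lemma exists_edge_one_triangle (E : rel T) (A : {set T}) v :
  symmetric E -> irreflexive E -> uncrossed_on E A -> v \in A ->
  0 < degree_in E A v ->
  exists2 a, (a \in A) && E v a & #|[set c in A | E v c && E a c]| <= 1.
Proof.
move=> Es Ei U vA; rewrite degree_inE; set N := [set y in A | E v y].
case/card_gt0P => a0 a0N.
have NA x : x \in N -> [/\ x \in A, E v x & x != v].
  rewrite inE => /andP[xA vx]; split=> //.
  by apply: contraTneq vx => ->; rewrite Ei.
pose t : rel T := rotate v.
have tC x y : x != y -> t y x = ~~ t x y by apply: rotateC.
have tE a c d : a \in N -> c \in N -> d \in N -> a != c -> a != d -> E c d ->
    t a c = t a d.
  move=> /NA[aA va av] /NA[cA vc cv] /NA[dA vd dv] ac ad cd.
  apply: uncrossed_rotate; apply: U => //.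
  by rewrite ac ad !(eq_sym v) cv dv.
case: (arg_maxnP (fun a => #|outset t N a|) a0N) => a aN amax.
have [aA va av] := NA _ aN.
exists a; first by rewrite aA va.
apply/card_le1_eqP.
(* A common neighbour [b] with [t b a] would outrank [a]: by [tE] along the edge [ab], no other
   vertex of [N] tells [a] from [b]. *)
have key b b' : b \in N -> b' \in N -> b != b' -> E a b -> E a b' -> t b a -> False.
  move=> bN b'N bb' ab ab' tba.
  have nab : a != b by apply: contraTneq ab => ->; rewrite Ei.
  have /= := amax b bN; rewrite /geq /= leqNgt => /negP; apply.
  apply: outset_proper => // c cN ca cb.
  by apply: tE.
move=> b b'; rewrite !inE => /and3P[bA vb ab] /and3P[b'A vb' ab'].
apply/eqP; rewrite eq_sym; apply/negPn/negP => nbb'.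
have bN : b \in N by rewrite inE bA.
have b'N : b' \in N by rewrite inE b'A.
have nab : a != b by apply: contraTneq ab => ->; rewrite Ei.
have nab' : a != b' by apply: contraTneq ab' => ->; rewrite Ei.
(* Exactly one of [t b b'] and [t b' b] holds, and the edges [ab'] and [ab] carry this over to
   [t b a] and [t b' a], so [key] applies to [b] or to [b']. *)
have h1 : t b b' = t b a by apply: tE => //; rewrite 1?eq_sym // Es.
have h2 : t b' b = t b' a by apply: tE => //; rewrite 1?eq_sym // Es.
have := tC _ _ nbb'; rewrite h1 h2.
case tba : (t b a) => tb'a; first exact: (key b b').
by apply: (key b' b) => //; rewrite eq_sym.
Qed.

Definition contract (E : rel T) (x v : T) : rel T := fun p q =>
  (p != q) && [|| E p q, (p == x) && E v q | (q == x) && E p v].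

(** An edge [xb] inherited from [vb] is replaced by the path [x], [v], [b]. Two inherited edges
    share the end [x], so they are never disjoint. *)
Lemma uncrossed_on_contract (E : rel T) (A : {set T}) x v :
  symmetric E -> uncrossed_on E A -> x \in A -> v \in A -> E x v ->
  uncrossed_on (contract E x v) (A :\ v).
Proof.
move=> Es U xA vA xv.
have half a b c d : a \in A :\ v -> b \in A :\ v -> c \in A :\ v -> d \in A :\ v ->
    [&& a != c, a != d, b != c & b != d] -> contract E x v a b -> E c d ->
    uncrossed a b c d.
  rewrite !in_setD1 => /andP[av aA] /andP[bv bA] /andP[cv cA] /andP[dv dA].
  move=> /and4P[ac ad bc bd] /andP[nab].
  case/or3P => [ab|/andP[/eqP ax vb]|/andP[/eqP bx av']] cd.
  - by apply: U => //; rewrite ac ad bc bd.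
  - move: ac ad nab aA; rewrite ax => ac ad nab aA.
    apply: (@uncrossed_trans _ v); apply: U => //; apply/and4P; split=> //;
      by rewrite eq_sym.
  - move: bc bd nab bA; rewrite bx => bc bd nab bA; rewrite uncrossedC.
    apply: (@uncrossed_trans _ v); apply: U; rewrite // 1?Es //;
      apply/and4P; split=> //; by rewrite eq_sym.
move=> a b c d aA bA cA dA D ab cd.
have /and4P[ac ad bc bd] := D.
have [E1|nE] := boolP (E c d); first exact: half.
have [E1|nE'] := boolP (E a b).
  by rewrite uncrossed_sym //; apply: half => //; rewrite ![c == _]eq_sym ![d == _]eq_sym ac ad bc bd.
move: ab cd; rewrite /contract (negPf nE) (negPf nE') /=.
case/andP => _ /orP[] /andP[/eqP e1 _] /andP[_ /orP[] /andP[/eqP e2 _]].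
- by rewrite e1 e2 eqxx in ac.
- by rewrite e1 e2 eqxx in ad.
- by rewrite e1 e2 eqxx in bc.
- by rewrite e1 e2 eqxx in bd.
Qed.

(** Contracting an edge that lies in at most one triangle removes one vertex and at most two edges:
    the edge itself and one of two parallel edges. The resulting 2m - 3 is doubled, as
    [ordered_edges] counts each edge twice. *)
Lemma ordered_edges_bound (E : rel T) (A : {set T}) :
  symmetric E -> irreflexive E -> uncrossed_on E A -> 1 < #|A| ->
  ordered_edges E A + 6 <= 4 * #|A|.
Proof.
move: {2}#|A| (leqnn #|A|) => n; elim: n => [|n IH] in E A *; first lia.
move=> An Es Ei U A1.
have [v vA] : exists v, v \in A by apply/card_gt0P; lia.
have cAv : #|A| = #|A :\ v|.+1 by rewrite (cardsD1 v) vA.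
have dv : degree_in E A v = degree_in E (A :\ v) v.
  by rewrite /degree_in (big_setD1 v) //= Ei.
have [d0|dpos] := posnP (degree_in E A v).
  rewrite (ordered_edges_rem Es Ei vA) -dv d0.
  have Uv : uncrossed_on E (A :\ v).
    by move=> a b c d /setD1P[_ ?] /setD1P[_ ?] /setD1P[_ ?] /setD1P[_ ?]; apply: U.
  have [A2|A2] := ltnP 1 #|A :\ v|.
    by have := IH E (A :\ v) ltac:(lia) Es Ei Uv A2; lia.
  have /cards1P[w Ew] : #|A :\ v| == 1 by lia.
  by rewrite /ordered_edges cAv Ew cards1 !big_set1 Ei.
have [x /andP[xA vx] tri] := exists_edge_one_triangle Es Ei U vA dpos.
have xv : x != v by apply: contraTneq vx => ->; rewrite Ei.
set F := contract E x v.
have Fs : symmetric F.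
  move=> p q; rewrite /F /contract eq_sym Es; congr (_ && (_ || _)).
  by rewrite orbC (Es p v) (Es v q).
have Fi : irreflexive F by move=> p; rewrite /F /contract eqxx.
have xAv : x \in A :\ v by rewrite !inE xv.
rewrite (ordered_edges_rem Es Ei vA) (ordered_edges_rem Es Ei xAv).
have UF : uncrossed_on F (A :\ v) by apply: uncrossed_on_contract; rewrite // Es.
set B := A :\ v :\ x.
have FB : ordered_edges F B = ordered_edges E B.
  apply: eq_bigr => p; rewrite !inE => /and3P[px _ _].
  apply: eq_bigr => q; rewrite !inE => /and3P[qx _ _].
  rewrite /F /contract (negPf px) (negPf qx) /= !orbF.
  by case: eqP => // ->; rewrite Ei.
have dF : degree_in F B x = #|[set y in B | E x y] :|: [set y in B | E v y]|.
  rewrite degree_inE; apply: eq_card => y; rewrite !inE /F /contract eqxx /=.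
  by rewrite (eq_sym x y); case: eqP => //= _; case: eqP => //= _; rewrite orbF; case: (y \in A).
have dvx : degree_in E (A :\ v) v = (degree_in E B v).+1.
  by rewrite /degree_in (big_setD1 x) //= vx.
have cB : #|[set y in B | E x y] :&: [set y in B | E v y]| <= 1.
  apply: leq_trans tri; apply/subset_leq_card/subsetP => y.
  by rewrite !inE => /andP[/andP[/and3P[_ _ ->] ->] /andP[_ ->]].
have := cardsUI [set y in B | E x y] [set y in B | E v y].
rewrite -dF -!degree_inE => cUI.
have [A2|A2] := ltnP 1 #|A :\ v|.
  have := IH F (A :\ v) ltac:(lia) Fs Fi UF A2.
  rewrite (ordered_edges_rem Fs Fi xAv) FB -/B dvx; lia.
have B0 : B = set0.
  apply/eqP; rewrite -cards_eq0.
  have := cardsD1 x (A :\ v); rewrite xAv -/B; lia.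
rewrite dvx /ordered_edges /degree_in B0 !big_set0; lia.
Qed.

End EdgeBound.

(** * Excess bound for bipartite graphs *)

Section BipartiteBound.

Definition bip_uncrossed (E : rel T) (A B : {set T}) : Prop :=
  forall a b c d, a \in A -> b \in B -> c \in A -> d \in B ->
    a != c -> b != d -> E a b -> E c d -> uncrossed a b c d.

Definition nbrs (E : rel T) (A : {set T}) (b : T) : {set T} := [set a in A | E a b].

Section Star.
Variables (E : rel T) (A B : {set T}) (b : T).
Hypothesis dAB : [disjoint A & B].
Hypothesis U : bip_uncrossed E A B.
Hypothesis bB : b \in B.

Let N := nbrs E A b.
Let t : rel T := rotate b.

Let nAB x y : x \in A -> y \in B -> x != y.
Proof. by move=> xA yB; apply: contraTneq xA => ->; rewrite (disjointFl dAB). Qed.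

Let tE a c q : a \in N -> c \in A -> q \in B -> a != c -> q != b -> E c q ->
  t a c = t a q.
Proof.
rewrite inE => /andP[aA ab] cA qB ac qb cq; apply: uncrossed_rotate.
by rewrite uncrossedC; apply: U => //; rewrite eq_sym.
Qed.

Let tC x y : x != y -> t y x = ~~ t x y. Proof. exact: rotateC. Qed.

(** The pairs of edges [ab], [cq] and [cb], [aq] show that [q] separates [a] from [c] in the order
    cut open at [b]. *)
Let tAC a c q : a \in N -> c \in N -> q \in B -> q != b -> a != c -> E a q -> E c q ->
  t c q = ~~ t a q.
Proof.
move=> aN cN qB qb ac aq cq.
have [aA cA] : a \in A /\ c \in A by move: aN cN; rewrite !inE => /andP[-> _] /andP[-> _].
rewrite -(tE cN aA qB) //; last by rewrite eq_sym.
by rewrite -(tE aN cA qB) // tC.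
Qed.

(** By [tAC], three common neighbours of [b] and [q] would give three pairwise distinct booleans. *)
Lemma card_common_nbrs q : q \in B -> q != b -> #|N :&: nbrs E A q| <= 2.
Proof.
move=> qB qb; rewrite leqNgt; apply/negP => /card_gt2P[x [y [z [[xI yI zI] [xy yz zx]]]]].
move: xI yI zI; rewrite !in_setI ![_ \in nbrs E A q]inE.
move=> /and3P[xN xA xq] /and3P[yN yA yq] /and3P[zN zA zq].
have := tAC xN yN qB qb xy xq yq; have := tAC yN zN qB qb yz yq zq.
have := tAC zN xN qB qb zx zq xq.
by case: (t x q) (t y q) (t z q) => [] [] [].
Qed.

Let Q := [set q in B :\ b | 1 < #|N :&: nbrs E A q|].
(** For [q] in [Q], exactly one of the two common neighbours of [b] and [q] qualifies, by [tAC]. The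
    map is injective on [Q] and misses a vertex of [N]. *)
Let phi q := [pick a in N | E a q && t a q].

Let QP q : q \in Q -> exists a c,
  [/\ phi q = Some a, [/\ a \in N, a \in A, E a q & t a q],
     [/\ c \in N, c \in A & E c q], t c q = false & a != c].
Proof.
rewrite inE in_setD1 => /andP[/andP[qb qB]] /card_gt1P[x [y [xI yI xy]]].
move: xI yI; rewrite !in_setI ![_ \in nbrs E A q]inE.
move=> /and3P[xN xA xq] /and3P[yN yA yq].
have txy := tAC xN yN qB qb xy xq yq.
rewrite /phi; case: pickP => [a /and3P[aN aq taq]|H]; last first.
  have := H x; have := H y; rewrite xN yN xq yq txy /= => /negbFE ->; by [].
have aA : a \in A by move: aN; rewrite inE => /andP[].
have [ax|ax] := eqVneq a x.
  exists a, y; split=> //; last by rewrite ax.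
  by rewrite txy -ax taq.
exists a, x; split=> //.
by rewrite (tAC aN xN qB qb ax aq xq) taq.
Qed.

Let QB q : q \in Q -> q \in B /\ q != b.
Proof. by rewrite inE in_setD1 => /andP[/andP[]]. Qed.

Let phi_inj : {in Q &, injective phi}.
Proof.
move=> q q' qQ q'Q; have [[qB qb] [q'B q'b]] := (QB qQ, QB q'Q).
have [a [c [-> [aN aA aq taq] [cN cA cq] tcq ac]]] := QP qQ.
have [a' [c' [-> [a'N a'A aq' taq'] [c'N c'A c'q'] tc'q' ac']]] := QP q'Q.
case=> aa'; move: a'N a'A aq' taq' ac'; rewrite -{a'}aa' => _ _ aq' taq' ac'.
apply/eqP/negPn/negP => qq'.
have tac : t a c by rewrite (tE aN cA qB).
have tac' : t a c' by rewrite (tE aN c'A q'B).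
(* If [c = c'], the disjoint edges [aq], [cq'] and [aq'], [cq] force both [t q q'] and [t q' q].
   Otherwise [t c c'] and [t c' c] both reduce to comparisons with [a], and both fail. *)
have [cc'|cc'] := eqVneq c c'.
  have rot x y z w : uncrossed x y z w -> ~~ (t x z (+) t x w (+) t y z (+) t y w).
    rewrite /uncrossed /t /rotate.
    by case: (r x z) (r x w) (r y z) (r y w) (r b x) (r b y) (r b z) (r b w)
       => [] [] [] [] [] [] [] [].
  move: c'q' tc'q'; rewrite -cc' => cq' tcq'.
  have qc := nAB cA qB; have q'c := nAB cA q'B.
  have tqc : t q c by rewrite tC // tcq.
  have tq'c : t q' c by rewrite tC // tcq'.
  have := rot _ _ _ _ (U aA qB cA q'B ac qq' aq cq').
  have := rot _ _ _ _ (U aA q'B cA qB ac ltac:(by rewrite eq_sym) aq' cq).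
  by rewrite tac taq taq' tqc tq'c (tC qq'); case: (t q q').
have h1 : t c c' = false.
  rewrite (tE cN c'A q'B) // -(tE cN aA q'B) //; last by rewrite eq_sym.
  by rewrite tC // tac.
have h2 : t c' c = false.
  rewrite (tE c'N cA qB) //; last by rewrite eq_sym.
  by rewrite -(tE c'N aA qB) // 1?eq_sym // tC // tac'.
by have := tC cc'; rewrite h1 h2.
Qed.

(** The vertex of [N] with the smallest outset is not a value of [phi]: the other common neighbour
    of [b] and [q] has a smaller outset than [phi q]. *)
Lemma card_doubly_linked : 0 < #|N| -> #|[set q in B :\ b | 1 < #|N :&: nbrs E A q|]| < #|N|.
Proof.
case/card_gt0P => x0 x0N; rewrite -/Q.
case: (arg_minnP (fun a => #|outset t N a|) x0N) => m mN mmin; have {}mN : m \in N := mN.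
rewrite -(card_in_imset phi_inj) [X in _ < X](cardsD1 m) mN ltnS.
rewrite -(card_imset (N :\ m) (@Some_inj _)); apply/subset_leq_card/subsetP => o.
case/imsetP => q qQ ->; have [qB qb] := QB qQ.
have [a [c [-> [aN aA aq taq] [cN cA cq] tcq ac]]] := QP qQ.
rewrite imset_f // in_setD1 aN andbT; apply/eqP => am.
have /= := mmin c cN; rewrite -am leqNgt => /negP; apply.
have ca : c != a by rewrite eq_sym.
apply: outset_proper => //; first by rewrite (tE aN cA qB).
by move=> x xN xc xa; rewrite (tE xN cA qB) // (tE xN aA qB).
Qed.

End Star.

(* Contract the star formed by [b] and its neighbours: the excess of [b] is lost, and
   every doubly linked vertex loses one more edge. *)
Lemma bipartite_excess_bound (E : rel T) (A B : {set T}) :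
  [disjoint A & B] -> bip_uncrossed E A B ->
  \sum_(b in B) #|nbrs E A b|.-1 <= 2 * #|A|.-1.
Proof.
move: {2}#|B| (leqnn #|B|) => n; elim: n => [|n IH] in E A B *.
  by rewrite leqn0 cards_eq0 => /eqP->; rewrite big_set0.
move=> Bn dAB U.
have [/exists_inP[b bB b2]|] := boolP [exists b in B, 1 < #|nbrs E A b|]; last first.
  rewrite negb_exists_in => /forall_inP H; rewrite big1 // => b /H; lia.
set N := nbrs E A b in b2.
have NA : N \subset A by apply/subsetP => x; rewrite inE => /andP[].
have [a0 a0N] : exists a0, a0 \in N by apply/card_gt0P; lia.
have a0A := subsetP NA _ a0N.
(* The star shrinks to [a0], which inherits through [F] the edges of all vertices of [N]. *)
pose A' := A :\: (N :\ a0); pose B' := B :\ b.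
pose F : rel T := fun p q => if p == a0 then [exists a in N, E a q] else E p q.
have cA : #|A'| + #|N| = #|A|.+1.
  rewrite /A' cardsDS; last by apply: subset_trans (subD1set _ _) NA.
  have := subset_leq_card NA; have := cardsD1 a0 N; rewrite a0N; lia.
have cB : #|B| = #|B'|.+1 by rewrite (cardsD1 b) bB.
have a0A' : a0 \in A' by rewrite !inE eqxx a0A.
have A'A x : x \in A' -> x \in A by rewrite inE => /andP[].
have A'N x : x \in A' -> x != a0 -> x \notin N.
  by rewrite !inE => /andP[H _] /negPf xa0; move: H; rewrite xa0.
have B'B x : x \in B' -> x \in B /\ x != b by rewrite !inE => /andP[].
have dAB' : [disjoint A' & B'].
  by apply: disjointWl (disjointWr _ dAB); [apply: subsetDl | apply: subD1set].
have nAB x y : x \in A -> y \in B -> x != y.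
  by move=> xA yB; apply: contraTneq xA => ->; rewrite (disjointFl dAB).
have half q c d : q \in B' -> c \in A' -> d \in B' -> c != a0 -> q != d ->
    F a0 q -> E c d -> uncrossed a0 q c d.
  move=> /B'B[qB qb] cA' /B'B[dB db] ca0 qd; rewrite /F eqxx => /exists_inP[a aN aq] cd.
  have cN := A'N _ cA' ca0; have cA'' := A'A _ cA'.
  have [aA ab] : a \in A /\ E a b by move: aN; rewrite inE => /andP[].
  have a0b : E a0 b by move: a0N; rewrite inE => /andP[].
  have ac : a != c by apply: contraNneq cN => <-.
  (* The edge [a0 q] is replaced by the path [a0], [b], [a], [q]. *)
  apply: (@uncrossed_trans _ b); first by apply: U; rewrite // eq_sym.
  apply: (@uncrossed_trans _ a); last by apply: U.
  by rewrite uncrossedC; apply: U; rewrite // eq_sym.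
have U' : bip_uncrossed F A' B'.
  move=> p q c d pA qB cA' dB pc qd.
  have [pa0|pa0] := eqVneq p a0.
    rewrite pa0 => Fq; rewrite /F; case: eqP => [ca0|_]; last first.
      by move=> cd; apply: half => //; rewrite -pa0 eq_sym.
    by rewrite pa0 ca0 eqxx in pc.
  rewrite {1}/F (negPf pa0) => pq.
  have [ca0|ca0] := eqVneq c a0.
    rewrite ca0 => Fd; have [dB1 _] := B'B _ dB; have [qB1 _] := B'B _ qB.
    have qa0 : q != a0 by rewrite eq_sym nAB.
    have qd' : q != d by [].
    rewrite uncrossed_sym //; last by apply: nAB => //; apply: A'A.
    by apply: half; rewrite // eq_sym.
  rewrite /F (negPf ca0) => cd.
  by apply: U; rewrite ?A'A //; [case: (B'B _ qB) | case: (B'B _ dB)].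
rewrite (big_setD1 b) //= -/N -/B'.
have := IH F A' B' ltac:(lia) dAB' U'.
have cQ := card_doubly_linked dAB U bB ltac:(rewrite -/N; lia).
set Q := [set q in B' | 1 < #|N :&: nbrs E A q|]; rewrite -/N -/B' -/Q in cQ.
(* At most two neighbours of [q] lie in [N], and they become [a0]. So the excess drops by at most
   one, and only for [q] in [Q]. *)
have deg q : q \in B' -> #|nbrs E A q|.-1 <= #|nbrs F A' q|.-1 + (q \in Q).
  move=> qB'; have [qB qb] := B'B _ qB'.
  have := card_common_nbrs U bB qB qb; rewrite -/N.
  have := cardsID N (nbrs E A q); rewrite setIC.
  have sub : nbrs E A q :\: N \subset nbrs F A' q :\ a0.
    apply/subsetP => x; rewrite inE [x \in nbrs E A q]inE => /and3P[xN xA xq].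
    have xa0 : x != a0 by apply: contraNneq xN => ->.
    by rewrite in_setD1 xa0 inE /F (negPf xa0) xq andbT !in_setD xA (negPf xN) andbF.
  have := subset_leq_card sub; rewrite /Q inE qB' /=.
  have := cardsD1 a0 (nbrs F A' q).
  have [I0|I0] := posnP #|N :&: nbrs E A q|; first by rewrite I0; clear; lia.
  have -> : a0 \in nbrs F A' q.
    case/card_gt0P: I0 => x; rewrite !in_setI [x \in nbrs E A q]inE => /and3P[xN xA xq].
    by rewrite inE a0A' /F eqxx; apply/exists_inP; exists x.
  by clear -I0; case: ltnP; lia.
have : \sum_(q in B') #|nbrs E A q|.-1 <= \sum_(q in B') #|nbrs F A' q|.-1 + #|Q|.
  apply: (@leq_trans (\sum_(q in B') (#|nbrs F A' q|.-1 + (q \in Q)))).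
    exact: leq_sum.
  rewrite big_split /= leq_add2l.
  rewrite -sum1_card big_mkcond [X in _ <= X]big_mkcond; apply: leq_sum => x _.
  by case: (x \in B'); case: (x \in Q).
have : 0 < #|A'| by apply/card_gt0P; exists a0.
(* Both [b] and the vertices of [Q] account for a loss of at most [#|N|.-1], while [A] loses
   [#|N|.-1] vertices, each worth 2. *)
lia.
Qed.

End BipartiteBound.

(** * Number of edges against the size of a maximum matching *)

Section MatchingBound.
Variable H : {set {set T}}.
Hypothesis H2 : forall e, e \in H -> #|e| = 2.
Hypothesis UH : forall a b c d, [set a; b] \in H -> [set c; d] \in H ->
  [&& a != c, a != d, b != c & b != d] -> uncrossed a b c d.

Let E : rel T := fun x y => [set x; y] \in H.

Let Es : symmetric E. Proof. by move=> x y; rewrite /E setUC. Qed.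

Let Ei : irreflexive E.
Proof.
by move=> x; apply/negP => /H2; rewrite setUid cards1.
Qed.

Let UE A : uncrossed_on E A.
Proof. by move=> a b c d _ _ _ _ D ab cd; apply: UH. Qed.

Lemma card_edges_ordered : #|H| * 2 <= ordered_edges E [set: T].
Proof.
rewrite -sum_nat_const /ordered_edges.
have -> : \sum_(x in [set: T]) \sum_(y in [set: T]) E x y =
          \sum_(p : T * T | E p.1 p.2) 1.
  rewrite pair_big /= [RHS]big_mkcond; apply: eq_big => [p|p _].
    by rewrite !inE.
  by case: (E _ _).
rewrite (partition_big (fun p : T * T => [set p.1; p.2]) (mem H)) //=.
apply: leq_sum => e eH; have /eqP/cards2P[x [y [xy exy]]] := H2 eH.
rewrite (bigD1 (x, y)) /=; last by rewrite /E -exy eH eqxx.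
rewrite (bigD1 (y, x)) //=.
by rewrite /E (setUC [set y]) -exy eH eqxx xpair_eqE eq_sym (negPf xy).
Qed.

Lemma maximum_matching_exists : exists M : {set {set T}},
  [/\ M \subset H, trivIset M &
      forall M' : {set {set T}}, M' \subset H -> trivIset M' -> #|M'| <= #|M|].
Proof.
pose P := [pred M : {set {set T}} | (M \subset H) && trivIset M].
have P0 : P set0.
  by rewrite /= sub0set; apply/trivIsetP => A B; rewrite inE.
case: (arg_maxnP (fun M : {set {set T}} => #|M|) P0) => M /andP[MH Mt] Mmax.
by exists M; split=> // M' M'H M't; apply: Mmax; rewrite /= M'H.
Qed.

Section Maximum.
Variable M : {set {set T}}.
Hypothesis MH : M \subset H.
Hypothesis Mt : trivIset M.
Hypothesis Mmax : forall M' : {set {set T}},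
  M' \subset H -> trivIset M' -> #|M'| <= #|M|.

Let V := cover M.
Let I := ~: V.

Lemma trivIset_add (P : {set {set T}}) (e : {set T}) :
  trivIset P -> (forall f, f \in P -> [disjoint e & f]) -> trivIset (e |: P).
Proof.
move=> /trivIsetP Pt D; apply/trivIsetP => A B /setU1P[->|AP] /setU1P[->|BP].
- by rewrite eqxx.
- by move=> _; apply: D.
- by move=> _; rewrite disjoint_sym; apply: D.
- exact: Pt.
Qed.

Let in_I m x : m \in M -> x \in I -> x \notin m.
Proof.
by move=> mM; rewrite inE; apply: contra => xm; apply/bigcupP; exists m.
Qed.

Let card_V : #|V| = 2 * #|M|.
Proof.
rewrite -(eqP Mt) (eq_bigr (fun=> 2)); first by rewrite sum_nat_const mulnC.
by move=> e eM; apply/H2/(subsetP MH).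
Qed.

Let unmatched_independent x y : x \in I -> y \in I -> E x y = false.
Proof.
move=> xI yI; apply/negP; rewrite /E => xy.
have D f : f \in M -> [disjoint [set x; y] & f].
  move=> fM; rewrite disjoints_subset; apply/subsetP => z.
  by rewrite in_setC => /set2P[]->; apply: in_I.
have e0 : [set x; y] \notin M.
  by apply: contraTN isT => /in_I/(_ xI); rewrite !inE eqxx.
have := Mmax (M' := [set x; y] |: M).
rewrite subUset sub1set xy MH cardsU1 e0 => /(_ isT (trivIset_add Mt D)); lia.
Qed.

(* Otherwise [x - u = v - y] would be an augmenting path. *)
Let no_augmenting u v x y : [set u; v] \in M -> x \in I -> y \in I ->
  E u x -> E v y -> x = y.
Proof.
rewrite /E => uvM xI yI ux vy; apply/eqP/negPn/negP => xy.
have uv : u != v.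
  by apply: contraTneq (subsetP MH _ uvM) => ->; have := Ei v; rewrite /E => ->.
have uV : u \notin I by apply/negP => /(in_I uvM); rewrite !inE eqxx.
have vV : v \notin I by apply/negP => /(in_I uvM); rewrite !inE eqxx orbT.
have neI z w : z \in I -> w \notin I -> z != w.
  by move=> zI; apply: contraNneq => <-.
pose M0 := M :\ [set u; v].
have D0 w z f : w \in [set u; v] -> z \in I -> f \in M0 -> [disjoint [set w; z] & f].
  rewrite in_setD1 => wuv zI /andP[fuv fM].
  rewrite disjoints_subset; apply/subsetP => t; rewrite in_setC => /set2P[]->; last exact: in_I.
  apply: contraNN fuv => wf; apply/eqP/esym/eqP; apply: contraTT wuv => ne.
  by have /trivIsetP/(_ _ _ uvM fM ne)/disjointFl-> := Mt.
have M0t : trivIset M0 by apply: trivIsetS Mt; apply: subD1set.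
have t1 : trivIset ([set v; y] |: M0).
  by apply: trivIset_add => // f; apply: D0; rewrite // !inE eqxx orbT.
have t2 : trivIset ([set u; x] |: ([set v; y] |: M0)).
  apply: trivIset_add => // f /setU1P[->|]; last by apply: D0; rewrite // !inE eqxx.
  rewrite disjoints_subset; apply/subsetP => t; rewrite !inE => /orP[]/eqP->.
    by rewrite (negPf uv) /= eq_sym neI.
  by rewrite (negPf xy) orbF neI.
have n1 : [set v; y] \notin M0.
  by rewrite in_setD1; apply/negP => /andP[_ /in_I/(_ yI)]; rewrite !inE eqxx orbT.
have n2 : [set u; x] \notin [set v; y] |: M0.
  rewrite in_setU1 negb_or; apply/andP; split.
    apply/eqP => /setP/(_ x); rewrite !inE eqxx orbT (negPf xy) orbF.
    by move/esym/eqP => xv; rewrite -xv xI in vV.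
  by rewrite in_setD1; apply/negP => /andP[_ /in_I/(_ xI)]; rewrite !inE eqxx orbT.
have := Mmax (M' := [set u; x] |: ([set v; y] |: M0)).
rewrite !subUset !sub1set ux vy (subset_trans (subD1set _ _) MH) !cardsU1 n1 n2.
move=> /(_ isT t2); rewrite (cardsD1 [set u; v] M) uvM -/M0 !add1n.
by rewrite ltnn.
Qed.

Let d w := degree_in E I w.

Let W := [set w in V | 1 < d w].

Let d_set w : d w = #|[set y in I | E w y]|. Proof. exact: degree_inE. Qed.

(** By [no_augmenting], if one end of [m] has two unmatched neighbours, the other has none; this
    case pays for the term [2 * (1 < d w)]. Otherwise each end has at most one. *)
Let matched_edge_degree m : m \in M ->
  \sum_(w in m) (d w + 2 * (1 < d w)) <= \sum_(w in m) (if 1 < d w then d w else 0) + 2.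
Proof.
move=> mM; have /eqP/cards2P[u [v [uv muv]]] := H2 (subsetP MH _ mM).
have mV w : w \in m -> w \in V by move=> wm; apply/bigcupP; exists m.
have big u' v' : m = [set u'; v'] -> 1 < d u' -> d v' = 0.
  move=> e; rewrite d_set => /card_gt1P[x [y [xu yu xy]]].
  apply/eqP; rewrite d_set -leqn0 leqNgt; apply/negP => /card_gt0P[z].
  rewrite inE => /andP[zI vz]; move: xu yu; rewrite !(inE, in_set) => /andP[xI ux] /andP[yI uy].
  have mM' : [set u'; v'] \in M by rewrite -e.
  have xI' : x \in I by rewrite inE. have yI' : y \in I by rewrite inE.
  have h1 := no_augmenting mM' xI' zI ux vz.
  have h2 := no_augmenting mM' yI' zI uy vz.
  by rewrite h1 h2 eqxx in xy.
have S (f : T -> nat) : \sum_(w in m) f w = f u + f v.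
  by rewrite muv big_setU1 ?inE //= big_set1.
rewrite !S; have := big u v muv; have := big v u; rewrite setUC => /(_ muv).
by case: (ltnP 1 (d u)); case: (ltnP 1 (d v)); lia.
Qed.

(** This is the bipartite bound for the sides [W] and [I]; adding one for each vertex of [I] turns
    excesses into degrees. *)
Let W_excess : 0 < #|W| -> \sum_(w in W) d w + 2 <= #|I| + 2 * #|W|.
Proof.
move=> W0.
have dWI : [disjoint W & I].
  by rewrite disjoints_subset setCK; apply/subsetP => x; rewrite inE => /andP[].
have UWI : bip_uncrossed E W I.
  move=> a b c e aW bI cW eI ac be ab ce; apply: UH => //.
  have nWI x y : x \in W -> y \in I -> x != y.
    by move=> xW yI; apply: contraTneq xW => ->; rewrite (disjointFl dWI).
  by rewrite ac be nWI // eq_sym nWI.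
have := bipartite_excess_bound dWI UWI.
have -> : \sum_(w in W) d w = \sum_(b in I) #|nbrs E W b|.
  rewrite /d /degree_in exchange_big; apply: eq_bigr => b _ /=.
  rewrite -sum1_card big_mkcond [RHS]big_mkcond; apply: eq_bigr => a _.
  by rewrite [_ \in nbrs _ _ _]inE; case: (a \in W); case: (E a b).
have : \sum_(b in I) #|nbrs E W b| <= \sum_(b in I) (#|nbrs E W b|.-1 + 1).
  by apply: leq_sum => b _; lia.
rewrite big_split /= sum1_card; lia.
Qed.

Lemma card_edges_maximum_matching : 2 * #|M|.+1 <= #|T| -> 0 < #|M| ->
  #|H| + 5 <= #|T| + 4 * #|M|.
Proof.
move=> hT M0.
have cI : #|I| + 2 * #|M| = #|T| by rewrite -card_V addnC cardsC.
have cut : \sum_(w in V) d w + 2 * #|W| <= \sum_(w in W) d w + 2 * #|M|.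
  have -> : \sum_(w in W) d w = \sum_(w in V) (if 1 < d w then d w else 0).
    rewrite -big_mkcondr; apply: eq_bigl => w; by rewrite inE.
  have -> : #|W| = \sum_(w in V) (1 < d w).
    rewrite -sum1_card big_mkcond [RHS]big_mkcond; apply: eq_bigr => w _.
    by rewrite inE; case: (w \in V); case: (1 < d w).
  rewrite big_distrr /= -big_split /= /V !big_trivIset //=.
  rewrite mulnC -sum_nat_const -big_split /=.
  by apply: leq_sum => m; apply: matched_edge_degree.
have cut' : \sum_(w in V) d w + 2 <= #|T|.
  (* If [W] is empty, [cut] leaves at most [2 * #|M|] edges, and [hT] provides two spare
     vertices. *)
  have [W0|W0] := posnP #|W|; last by have := W_excess W0; lia.
  move: cut; rewrite W0 (cards0_eq W0) big_set0; lia.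
have inner : ordered_edges E V + 6 <= 4 * #|V|.
  by apply: ordered_edges_bound; rewrite ?card_V //; lia.
have total : ordered_edges E [set: T] = ordered_edges E V + 2 * \sum_(w in V) d w.
  have split (f : T -> nat) : \sum_(x in [set: T]) f x = \sum_(x in V) f x + \sum_(x in I) f x.
    by rewrite (big_setID V) /= setTI setTD.
  rewrite /ordered_edges split (eq_bigr (fun x => \sum_(y in V) E x y + d x)); last first.
    by move=> x _; rewrite split.
  rewrite big_split /= -/(ordered_edges E V).
  have -> : \sum_(x in I) \sum_(y in [set: T]) E x y = \sum_(w in V) d w.
    rewrite (eq_bigr (fun x => \sum_(y in V) E x y)); last first.
      move=> x xI; rewrite split [X in _ + X]big1 ?addn0 // => y yI.
      by rewrite unmatched_independent.
    by rewrite exchange_big /=; do 2!apply: eq_bigr => ? _; rewrite Es.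
  lia.
have := card_edges_ordered; lia.
Qed.

End Maximum.

(** A maximum matching has at most k - 1 edges, which turns the constant 5 into 9. If it is empty,
    so is [H]. *)
Lemma card_edges_no_matching k : 1 < k -> 2 * k <= #|T| ->
  (forall M : {set {set T}}, M \subset H -> trivIset M -> #|M| < k) ->
  #|H| + 9 <= #|T| + 4 * k.
Proof.
move=> k1 kT noM; have [M [MH Mt Mmax]] := maximum_matching_exists.
have Mk := noM M MH Mt.
have [M0|M0] := posnP #|M|; last first.
  by have := card_edges_maximum_matching MH Mt Mmax ltac:(lia) M0; lia.
have -> : #|H| = 0; last by lia.
apply/eqP; rewrite cards_eq0 -subset0; apply/subsetP => e eH.
have t : trivIset [set e].
  by apply/trivIsetP => A B /set1P-> /set1P->; rewrite eqxx.
by have := Mmax [set e]; rewrite sub1set eH cards1 M0 => /(_ isT t).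
Qed.

End MatchingBound.

End Noncrossing.

(** * Rainbow matchings from one edge of each color *)

Section RainbowMatching.

Lemma rainbow_copy_of_matching (T : finType) (C : Type) (G : sgraph T)
    (col : {set T} -> C) (M : {set {set T}}) k :
  M \subset edges G -> trivIset M -> {in M &, injective col} -> k <= #|M| ->
  rainbow_copy G col (matching k).
Proof.
move=> MG /trivIsetP Mt col_inj kM.
pose e (i : 'I_k) : {set T} := enum_val (widen_ord kM i).
have eM i : e i \in M by apply: enum_valP.
have e_inj : injective e by move=> i j /enum_val_inj/(congr1 val)/= /val_inj.
have ends i : exists p : T * T, (p.1 != p.2) && (e i == [set p.1; p.2]).
  have /eqP/cards2P[x [y [xy exy]]] := card_edge (subsetP MG _ (eM i)).
  by exists (x, y); rewrite /= xy -exy eqxx.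
pose p i := xchoose (ends i).
have pneq i : (p i).1 != (p i).2 by case/andP: (xchooseP (ends i)).
have pE i : e i = [set (p i).1; (p i).2] by case/andP: (xchooseP (ends i)) => _ /eqP.
pose h (u : 'I_k * bool) := if u.2 then (p u.1).2 else (p u.1).1.
have he u : h u \in e u.1 by rewrite pE /h; case: u.2; rewrite !inE eqxx ?orbT.
have h_edge i : h @: [set (i, false); (i, true)] = e i.
  by rewrite imsetU1 imset_set1 pE.
exists h; split.
- move=> [i b] [j c] hij.
  have eij : e i = e j.
    apply/eqP/negPn/negP => /(Mt _ _ (eM i) (eM j))/disjointFr/(_ (he (i, b)))/negP; apply.
    by rewrite hij (he (j, c)).
  have ij := e_inj _ _ eij; move: hij; rewrite -ij /h /=; have := pneq i.
  by case: b c => [] [] //= + E; rewrite E eqxx.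
- by move=> _ /imsetP[i _ ->]; rewrite h_edge; apply: (subsetP MG).
- move=> _ _ /imsetP[i _ ->] /imsetP[j _ ->]; rewrite !h_edge => /(col_inj _ _ (eM i) (eM j)).
  by move=> /e_inj ->.
Qed.

Lemma rainbow_free_colors_bound (T : finType) (G : sgraph T) (r : rel T) c
    (col : {set T} -> 'I_c) k :
  (forall x y, x != y -> r y x = ~~ r x y) ->
  (forall a b c d, [set a; b] \in G -> [set c; d] \in G ->
     [&& a != c, a != d, b != c & b != d] -> uncrossed r a b c d) ->
  col @: edges G = [set: 'I_c] -> ~ rainbow_copy G col (matching k) ->
  1 < k -> 2 * k <= #|T| -> c + 9 <= #|T| + 4 * k.
Proof.
move=> rC rU colG norainbow k1 kT.
have ex i : exists e, (e \in edges G) && (col e == i).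
  have : i \in col @: edges G by rewrite colG inE.
  by case/imsetP => e eG ->; exists e; rewrite eG eqxx.
pose rep i := xchoose (ex i).
have repG i : rep i \in edges G by case/andP: (xchooseP (ex i)).
have repK : cancel rep col by move=> i; case/andP: (xchooseP (ex i)) => _ /eqP.
pose H := rep @: [set: 'I_c].
have HG : H \subset edges G by apply/subsetP => _ /imsetP[i _ ->].
have <- : #|H| = c by rewrite card_imset ?cardsT ?card_ord //; apply: can_inj repK.
apply: (card_edges_no_matching rC) => //.
- by move=> e /(subsetP HG); apply: card_edge.
- by move=> a b c' d /(subsetP HG) ab /(subsetP HG) cd; apply: rU.
move=> M MH Mt; rewrite ltnNge; apply/negP => kM; apply: norainbow.
apply: (rainbow_copy_of_matching (M := M)) => //; first exact: subset_trans HG.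
move=> _ _ /(subsetP MH)/imsetP[i _ ->] /(subsetP MH)/imsetP[j _ ->].
by rewrite !repK => ->.
Qed.

End RainbowMatching.

(** * From plane embeddings to tournaments *)

From mathcomp Require Import all_classical all_reals all_analysis.
Import Order.TTheory GRing.Theory Num.Theory.
Import numFieldNormedType.Exports.

Local Open Scope classical_set_scope.
Local Open Scope ring_scope.

(** * Crossing parities of polygonal lines *)

Section Winding.
Variable R : realType.
Implicit Types (u v w z : R * R) (p q : nat -> R * R).

(** Half of the horizontal axis is included, so that exactly one of [u] and [- u] is upper when [u]
    is nonzero. *)
Definition upper u : bool := (0 < u.2) || ((u.2 == 0) && (0 < u.1)).

(** This detects a crossing with the positive horizontal axis for segments short compared with their
    distance to the origin; by [same_side] the abscissa of [u] then decides. *)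
Definition crossing u v : bool := (upper u != upper v) && (0 < u.1).

Lemma upperN u : u != 0 -> upper (- u) = ~~ upper u.
Proof.
case: u => a b; rewrite /upper /= !oppr_gt0 oppr_eq0 => ab.
case: (ltrgtP b 0) => //= b0; case: (ltrgtP a 0) => //= a0.
by rewrite a0 b0 eqxx in ab.
Qed.

Lemma prod_norm_lt u e : (`|u| < e) = (`|u.1| < e) && (`|u.2| < e).
Proof. by rewrite prod_normE gt_max. Qed.

Lemma prod_norm_ge u e : (e <= `|u|) = (e <= `|u.1|) || (e <= `|u.2|).
Proof. by rewrite prod_normE le_max. Qed.

(** A short step that changes sides starts at an ordinate smaller than [e], so in the maximum norm
    the distance to the origin comes from the abscissa. *)
Lemma upper_switch u v e : e <= `|u| -> `|u - v| < e -> upper u != upper v ->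
  e <= `|u.1|.
Proof.
rewrite prod_norm_ge => /orP[//|u2]; rewrite prod_norm_lt => /andP[_ /= d2].
rewrite /upper => ne; exfalso; move: ne d2 u2.
case: u v => [u1 u2] [v1 v2] /= ne; rewrite ltr_norml => /andP[d2 d2'].
have [h|h] := ltP 0 u2.
  rewrite (ger0_norm (ltW h)) => e2; have v20 : 0 < v2 by lra.
  by rewrite h v20 in ne.
rewrite (ler0_norm h) => e2.
have v20 : v2 < 0 by lra. have u20 : u2 < 0 by lra.
by rewrite (lt_gtF u20) (lt_gtF v20) (lt_eqF u20) (lt_eqF v20) in ne.
Qed.

Lemma same_side u v e : e <= `|u| -> e <= `|v| -> `|u - v| < e ->
  upper u != upper v -> (0 < u.1) = (0 < v.1).
Proof.
move=> eu ev uv ne; have u1 := upper_switch eu uv ne.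
have v1 : e <= `|v.1| by apply: (upper_switch ev _ (v := u)); rewrite 1?distrC 1?eq_sym.
move: uv; rewrite prod_norm_lt => /andP[/= + _].
rewrite ltr_norml => /andP[d d'].
by case: (ltP 0 u.1) => h1; case: (ltP 0 v.1) => h2 //; move: u1 v1;
  rewrite ?(gtr0_norm h1) ?(gtr0_norm h2) ?(ler0_norm h1) ?(ler0_norm h2) => u1 v1; lra.
Qed.

(** The four corners are too close together to surround the origin, so the boundary of the cell
    meets the ray an even number of times. *)
Lemma crossing_cell u u' w w' e :
  (forall x, x \in [:: u; u'; w; w'] -> e <= `|x|) ->
  (forall x y, x \in [:: u; u'; w; w'] -> y \in [:: u; u'; w; w'] -> `|x - y| < e) ->
  crossing u u' (+) crossing w w' = crossing u w (+) crossing u' w'.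
Proof.
move=> far close; rewrite /crossing.
have S x y : x \in [:: u; u'; w; w'] -> y \in [:: u; u'; w; w'] ->
  upper x != upper y -> (0 < x.1) = (0 < y.1).
  by move=> xs ys; apply: same_side; [exact: far|exact: far|exact: close].
have := S u u'; have := S u w; have := S u w'; have := S u' w; have := S u' w'.
have := S w w'; rewrite !inE !eqxx !orbT /=.
move=> /(_ isT isT) + /(_ isT isT) + /(_ isT isT) + /(_ isT isT) + /(_ isT isT) + /(_ isT isT).
by case: (upper u) (upper u') (upper w) (upper w') (0 < u.1) (0 < u'.1) (0 < w.1) (0 < w'.1)
  => [] [] [] [] [] [] [] [] //=; do ?[move=> /(_ isT)//|move=> _].
Qed.

(** Negation exchanges the two halves of the horizontal axis, and a short step that changes sides
    crosses exactly one of them. *)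
Lemma crossingNN u v e : 0 < e -> e <= `|u| -> e <= `|v| -> `|u - v| < e ->
  crossing (- u) (- v) = crossing u v (+) upper u (+) upper v.
Proof.
move=> e0 eu ev uv; have nz x : e <= `|x| -> x != 0.
  by apply: contraTneq => ->; rewrite normr0 -ltNge.
rewrite /crossing !upperN ?nz //= oppr_gt0.
have [->|ne] := eqVneq (upper u) (upper v); first by rewrite eqxx addbb.
have := upper_switch eu uv ne.
by case: (upper u) (upper v) ne => [] [] //= _;
  case: ltrgtP => // ->; rewrite normr0 leNgt e0.
Qed.

(* Parity of the number of times the polygonal line [p 0, ..., p n] crosses the
   rightward horizontal ray from [z]. *)
Definition winding p n z : bool :=
  \big[addb/false]_(i < n) crossing (p i - z) (p i.+1 - z).

Lemma windingS p n z : winding p n.+1 z = winding p n z (+) crossing (p n - z) (p n.+1 - z).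
Proof. by rewrite /winding big_ord_recr. Qed.

(** Summing [crossing_cell] along the line cancels the inner sides of the cells; the two end sides
    remain. *)
Lemma winding_step p n z z' e :
  (forall i, (i <= n)%N -> e <= `|p i - z|) ->
  (forall i, (i <= n)%N -> e <= `|p i - z'|) ->
  (forall i, (i < n)%N -> `|p i - p i.+1| < e / 2) -> `|z - z'| < e / 2 ->
  winding p n z (+) winding p n z' =
  crossing (p 0%N - z) (p 0%N - z') (+) crossing (p n - z) (p n - z').
Proof.
move=> farz farz' fine zz'; have e0 : 0 < e by have := normr_ge0 (z - z'); lra.
elim: n => [|n IH] in farz farz' fine *; first by rewrite /winding !big_ord0 !addbb.
rewrite !windingS addbACA IH; last first.
- by move=> i le; apply: fine; rewrite ltnW.
- by move=> i le; apply: farz'; rewrite leqW.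
- by move=> i le; apply: farz; rewrite leqW.
rewrite (@crossing_cell (p n - z) (p n.+1 - z) (p n - z') (p n.+1 - z') e); first by rewrite addbA addbK.
- by move=> x; rewrite !inE => /or4P[]/eqP->; [apply: farz|apply: farz|apply: farz'|apply: farz'].
have small (s t a b : R * R) : (s == t) || (`|s - t| < e / 2) -> (a == b) || (`|a - b| < e / 2) ->
    `|s - a - (t - b)| < e.
  move=> h1 h2; have -> : s - a - (t - b) = (s - t) - (a - b).
    by rewrite !opprB [b - t]addrC addrACA [- a + b]addrC.
  apply: le_lt_trans (ler_normB _ _) _.
  have h1' : `|s - t| < e / 2 by case/orP: h1 => // /eqP->; rewrite subrr normr0; lra.
  have h2' : `|a - b| < e / 2 by case/orP: h2 => // /eqP->; rewrite subrr normr0; lra.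
  lra.
have fn := fine n (ltnSn n); have fn' := fn; rewrite distrC in fn'.
have zz'' := zz'; rewrite distrC in zz''.
by move=> x y; rewrite !inE => /or4P[]/eqP-> /or4P[]/eqP->; apply: small;
  rewrite ?eqxx ?fn ?fn' ?zz' ?zz'' ?orbT.
Qed.

(** Discrete form of the map from a square to the punctured plane: the differences [p i - q j] cross
    the ray evenly around the boundary. On two sides the difference is negated, and [crossingNN]
    produces the [upper] terms. *)
Lemma winding_grid p q n m e :
  (forall i j, (i <= n)%N -> (j <= m)%N -> e <= `|p i - q j|) ->
  (forall i, (i < n)%N -> `|p i - p i.+1| < e / 2) ->
  (forall j, (j < m)%N -> `|q j - q j.+1| < e / 2) -> 0 < e ->
  winding p n (q 0%N) (+) winding p n (q m) (+)
  winding q m (p 0%N) (+) winding q m (p n) =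
  upper (q 0%N - p 0%N) (+) upper (q m - p 0%N) (+)
  upper (q 0%N - p n) (+) upper (q m - p n).
Proof.
move=> far finep fineq e0.
elim: m => [|m IH] in far fineq *.
  rewrite /winding !big_ord0 addbb /=.
  by case: (upper (q 0%N - p 0%N)) (upper (q 0%N - p n)) => [] [].
have stp : winding p n (q m) (+) winding p n (q m.+1) =
  crossing (p 0%N - q m) (p 0%N - q m.+1) (+) crossing (p n - q m) (p n - q m.+1).
  apply: (@winding_step _ _ _ _ e) => //.
  - by move=> i le; apply: far.
  - by move=> i le; apply: far.
  - exact: fineq.
have neg i : (i <= n)%N -> crossing (p i - q m) (p i - q m.+1) =
    crossing (q m - p i) (q m.+1 - p i) (+) upper (q m - p i) (+) upper (q m.+1 - p i).
  move=> le; rewrite -(opprB (q m)) -(opprB (q m.+1)) (@crossingNN _ _ e) //.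
  - by rewrite distrC far.
  - by rewrite distrC far.
  - have -> : q m - p i - (q m.+1 - p i) = q m - q m.+1 by rewrite opprB addrA subrK.
    by have := fineq m (ltnSn m); lra.
rewrite !neg // in stp.
have := IH (fun i j hi hj => far i j hi (leqW hj)) (fun j hj => fineq j (ltnW hj)).
rewrite !windingS => /(congr2 addb)/(_ stp).
move: (winding p n (q m)) (winding p n (q m.+1)) (winding p n (q 0%N)) => a b c.
move: (winding q m (p 0%N)) (winding q m (p n)) => x y.
move: (crossing (q m - p 0%N) _) (crossing (q m - p n) _) => s t H.
move/(congr1 (fun l => l (+) (s (+) t))): H.
have -> : c (+) a (+) x (+) y (+) (a (+) b) (+) (s (+) t) = c (+) b (+) (x (+) s) (+) (y (+) t).
  by case: a b c x y s t => [] [] [] [] [] [] [].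
move=> ->; move: (upper _) (upper _) (upper _) (upper _) (upper _) (upper _).
by case: s t => [] [] [] [] [] [] [] [].
Qed.

End Winding.

(** * Crossing parities of continuous curves *)

Section Curves.
Variable R : realType.
Implicit Types (f h : R -> R * R) (z : R * R) (N : nat).

Definition sample f N (i : nat) : R * R := f (i%:R / N.+1%:R).

(** No limit is taken: relations between these parities are asserted for all large [N]. *)
Definition curve_winding f N z : bool := winding (sample f N) N.+1 z.

Lemma sample_domain N i : (i <= N.+1)%N -> `[0, 1]%classic (i%:R / N.+1%:R : R).
Proof.
move=> iN; rewrite /= in_itv /= divr_ge0 ?ler0n //= ler_pdivrMr ?ltr0n //.
by rewrite mul1r ler_nat.
Qed.

Lemma sample0 f N : sample f N 0 = f 0. Proof. by rewrite /sample mul0r. Qed.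

Lemma sample1 f N : sample f N N.+1 = f 1.
Proof. by rewrite /sample divff // pnatr_eq0. Qed.

(** Uniform continuity, from the compactness of the unit interval in its near-covering form. *)
Lemma fine_sampling f (eta : R) : {within `[0, 1], continuous f} -> 0 < eta ->
  \forall N \near \oo, forall i, (i < N.+1)%N ->
    `|sample f N i - sample f N i.+1| < eta.
Proof.
move=> /subspace_continuousP cf eta0.
pose P (N : nat) (s : R) := `[0, 1]%classic s -> forall t, `[0, 1]%classic t ->
  `|s - t| <= N.+1%:R^-1 -> `|f s - f t| < eta.
have nc : near_covering (`[0, 1]%classic : set R).
  exact/compact_near_coveringP/segment_compact.
have : \forall N \near \oo, `[0, 1]%classic `<=` P N.
  apply: nc => x x01.
  have [d d0 key] : exists2 d : R, 0 < d &
      forall s, `[0, 1]%classic s -> `|x - s| < d -> `|f x - f s| < eta / 2.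
    have /cvgrPdist_lt/(_ (eta / 2))/(_ ltac:(lra))[d /= d0 dP] := cf x x01.
    by exists d => // s s01 xs; apply: dP.
  have d2 : 0 < d / 2 by rewrite divr_gt0.
  near=> s N => s01 t t01 st.
  have xs : `|x - s| < d / 2 by near: s; exact: nbhsx_ballx.
  have Nd : N.+1%:R^-1 < d / 2 :> R.
    by near: N; exact: (near_infty_natSinv_lt (PosNum d2)).
  have f1 : `|f x - f s| < eta / 2 by apply: key => //; apply: lt_trans xs _; lra.
  have f2 : `|f x - f t| < eta / 2.
    apply: key => //; rewrite -(subrK s x) -addrA.
    apply: le_lt_trans (ler_normD _ _) _; rewrite [ltRHS](splitr d).
    by apply: ltrD => //; apply: le_lt_trans st Nd.
  rewrite -(subrK (f x) (f s)) -addrA; apply: le_lt_trans (ler_normD _ _) _.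
  by rewrite distrC [ltRHS](splitr eta); apply: ltrD.
apply: filterS => N NP i iN; have iN01 := sample_domain (ltnW iN).
apply: (NP _ iN01 iN01); first exact: sample_domain.
rewrite -mulrBl normrM -natr1 opprD addrA subrr sub0r normrN1 mul1r ger0_norm //.
Unshelve. all: end_near.
Qed.

Lemma compact_dist (K : set (R * R)) z : compact K -> ~ K z ->
  exists2 eta : R, 0 < eta & forall p, K p -> eta <= `|p - z|.
Proof.
move=> cK nKz; have clK : closed K by apply: compact_closed => //; exact: norm_hausdorff.
have : nbhs z (~` K) by apply: open_nbhs_nbhs; split=> //; exact: closed_openC.
move=> /nbhs_normP[eta /= eta0 H]; exists eta => // p Kp.
by rewrite leNgt; apply/negP => pz; apply: (H p) => //=; rewrite distrC.
Qed.

Lemma compact_curve f : {within `[0, 1], continuous f} -> compact (f @` `[0, 1]).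
Proof. by move=> cf; apply: continuous_compact => //; exact: segment_compact. Qed.

Lemma winding_near f z : {within `[0, 1], continuous f} -> ~ (f @` `[0, 1]) z ->
  \forall z' \near z, \forall N \near \oo,
    curve_winding f N z (+) curve_winding f N z' =
    crossing (f 0 - z) (f 0 - z') (+) crossing (f 1 - z) (f 1 - z').
Proof.
move=> cf nz; have [eta eta0 far] := compact_dist (compact_curve cf) nz.
(* [winding_step] is applied with [eta / 2], so [z'] and consecutive samples must move by less than
   [eta / 4]. *)
have eta4 : 0 < eta / 4 by lra.
have near_z : \forall z' \near z, `|z - z'| < eta / 4.
  by apply/nbhs_normP; exists (eta / 4).
apply: filterS near_z => z' zz'.
apply: filterS (fine_sampling cf eta4) => N fine.
have farz i : (i <= N.+1)%N -> eta <= `|sample f N i - z|.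
  by move=> iN; apply: far; exists (i%:R / N.+1%:R) => //; exact: sample_domain.
rewrite /curve_winding (@winding_step _ _ _ _ _ (eta / 2)) ?sample0 ?sample1 //.
- by move=> i /farz; lra.
- move=> i /farz; have := ler_normB (sample f N i - z') (z - z').
  by rewrite opprB addrA subrK; lra.
- by move=> i /fine; lra.
- by lra.
Qed.

(** The curve lies in the square of radius [M]. If [z] is to the left of it, each change of side is
    a crossing; otherwise the ray from [z] misses the square. *)
Lemma winding_far f N z (M : R) :
  (forall s, `[0, 1]%classic s -> `|f s| <= M) -> M < `|z| ->
  let g p := (z.1 < - M) && upper (p - z) in
  curve_winding f N z = g (f 0) (+) g (f 1).
Proof.
move=> fM Mz g; rewrite /curve_winding -(sample0 f N) -(sample1 f N).
have bnd i : (i <= N.+1)%N -> [&& - M <= (sample f N i).1, (sample f N i).1 <= M,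
    - M <= (sample f N i).2 & (sample f N i).2 <= M].
  move=> /(sample_domain)/fM; rewrite prod_normE ge_max !ler_norml.
  by move=> /andP[/andP[-> ->] /andP[-> ->]].
have step i : (i < N.+1)%N ->
    crossing (sample f N i - z) (sample f N i.+1 - z) =
    g (sample f N i) (+) g (sample f N i.+1).
  move=> iN; have /and4P[a1 a2 a3 a4] := bnd i (ltnW iN).
  have /and4P[b1 b2 b3 b4] := bnd _ iN.
  rewrite /crossing /g.
  case: (ltP z.1 (- M)) => z1.
    have -> : 0 < (sample f N i - z).1 by rewrite /= subr_gt0; lra.
    by rewrite andbT; case: (upper _) (upper _) => [] [].
  rewrite !andFb /=.
  have [z1'|z1'] := ltP M z.1.
    have -> : 0 < (sample f N i).1 - z.1 = false by apply/negbTE; rewrite -leNgt subr_le0; lra.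
    by rewrite andbF.
  have : M < `|z.2|.
    move: Mz; rewrite prod_normE lt_max => /orP[|//].
    by rewrite ltNge ler_norml z1 z1'.
  rewrite /upper /=; case: (ltP 0 z.2) => z2.
    rewrite (gtr0_norm z2) => Mz2.
    have h1 : (sample f N i).2 - z.2 < 0 by rewrite subr_lt0; lra.
    have h2 : (sample f N i.+1).2 - z.2 < 0 by rewrite subr_lt0; lra.
    by rewrite (lt_gtF h1) (lt_gtF h2) (lt_eqF h1) (lt_eqF h2).
  rewrite (ler0_norm z2) => Mz2.
  have h1 : 0 < (sample f N i).2 - z.2 by rewrite subr_gt0; lra.
  have h2 : 0 < (sample f N i.+1).2 - z.2 by rewrite subr_gt0; lra.
  by rewrite h1 h2.
have : forall n, (n <= N.+1)%N ->
    winding (sample f N) n z = g (sample f N 0) (+) g (sample f N n).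
  elim=> [_|n IH nN]; first by rewrite /winding big_ord0 addbb.
  by rewrite windingS IH 1?ltnW // step // addbA addbK.
by apply.
Qed.

(** The differences between points of the two curves form a compact set avoiding 0, which gives the
    distance required by [winding_grid]. *)
Lemma winding_disjoint f h :
  {within `[0, 1], continuous f} -> {within `[0, 1], continuous h} ->
  f @` `[0, 1] `&` h @` `[0, 1] = set0 ->
  \forall N \near \oo,
    curve_winding f N (h 0) (+) curve_winding f N (h 1) (+)
    curve_winding h N (f 0) (+) curve_winding h N (f 1) =
    upper (h 0 - f 0) (+) upper (h 1 - f 0) (+)
    upper (h 0 - f 1) (+) upper (h 1 - f 1).
Proof.
move=> cf ch fh0.
pose K := (fun p : (R * R) * (R * R) => p.1 - p.2) @`
  ((f @` `[0, 1]) `*` (h @` `[0, 1])).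
have cK : compact K.
  apply: continuous_compact; last by apply: compact_setX; exact: compact_curve.
  apply: continuous_subspaceT => p.
  by apply: cvgB; [exact: cvg_fst | exact: cvg_snd].
have nK0 : ~ K 0.
  case=> -[a b] [/= fa hb] /eqP; rewrite subr_eq0 => /eqP ab.
  by have : set0 a by rewrite -fh0; split=> //; rewrite ab.
have [eta eta0 far] := compact_dist cK nK0.
have eta2 : 0 < eta / 2 by lra.
near=> N; rewrite /curve_winding -(sample0 f N) -(sample0 h N) -(sample1 f N) -(sample1 h N).
apply: (@winding_grid _ _ _ _ _ eta) => //.
- move=> i j iN jN; rewrite -[_ - _]subr0; apply: far.
  exists (sample f N i, sample h N j) => //=; split=> /=.
    by exists (i%:R / N.+1%:R) => //; exact: sample_domain.
  by exists (j%:R / N.+1%:R) => //; exact: sample_domain.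
- by near: N; exact: fine_sampling.
- by near: N; exact: fine_sampling.
Unshelve. all: end_near.
Qed.

End Curves.

Lemma connected_invariant (X : topologicalType) (F P : set X) :
  connected F -> (forall z, F z -> \forall z' \near z, P z <-> P z') ->
  forall x y, F x -> P x -> F y -> P y.
Proof.
move=> cF loc x y Fx Px Fy.
suff E : F `&` P = F by move: Fy; rewrite -E => -[].
apply: cF; first by exists x.
- exists (P°); first exact: open_interior.
  apply/seteqP; split=> z [Fz Pz]; split=> //; last exact: interior_subset.
  by apply: filterS (loc z Fz) => z' [H _]; exact: H.
- exists (closure P); first exact: closed_closure.
  apply/seteqP; split=> z [Fz Pz]; split=> //; first exact: subset_closure.
  by have [z' [Pz' [_ H]]] := Pz _ (loc z Fz); exact: H.
Qed.

(** * The tournament of an outerplanar embedding *)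

Section Outerplanar.
Variables (R : realType) (T : finType) (G : sgraph T).

Let I := {e : {set T} | e \in edges G}.

Record parametrized_edge := ParametrizedEdge {
  tail : T; head : T; curve : R -> R * R }.

Lemma unbounded_set_far (F : set (R * R)) (M : R) :
  ~ bounded_set F -> exists2 z, F z & M < `|z|.
Proof.
move=> nb; apply: contrapT => H; apply: nb.
exists M; split; first exact: num_real.
move=> x Mx z Fz /=; apply: le_trans (ltW Mx).
by rewrite leNgt; apply/negP => Mz; apply: H; exists z.
Qed.

(* [g v x] is the parity of the crossings of the leftward ray from [x] with a path leaving
   [v] to infinity inside the outer face; such a path is replaced here by a
   connectedness argument. *)
Lemma outer_vertex_potential (pos : T -> R * R) (par : I -> parametrized_edge)
    (F : set (R * R)) (v : T) :
  (forall e, {within `[0, 1], continuous (curve (par e))}) ->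
  (forall e, curve (par e) 0 = pos (tail (par e))) ->
  (forall e, curve (par e) 1 = pos (head (par e))) ->
  (forall e : I, v \notin val e -> ~ (curve (par e) @` `[0, 1]) (pos v)) ->
  (forall e z, F z -> ~ (curve (par e) @` `[0, 1]) z) ->
  connected F -> ~ bounded_set F -> closure F (pos v) ->
  exists g : T -> bool, forall e : I, v \notin val e -> \forall N \near \oo,
    curve_winding (curve (par e)) N (pos v) = g (tail (par e)) (+) g (head (par e)).
Proof.
move=> cpar par0 par1 avoid_v avoid_F cF nbF clF.
pose P (z : R * R) := exists g : T -> bool, forall e : I, v \notin val e -> \forall N \near \oo,
    curve_winding (curve (par e)) N z = g (tail (par e)) (+) g (head (par e)).
have local z : (forall e : I, v \notin val e -> ~ (curve (par e) @` `[0, 1]) z) ->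
    \forall z' \near z, P z <-> P z'.
  move=> avoid.
  pose Q (e : I) (z' : R * R) := v \notin val e -> \forall N \near \oo,
      curve_winding (curve (par e)) N z (+) curve_winding (curve (par e)) N z' =
      crossing (pos (tail (par e)) - z) (pos (tail (par e)) - z') (+)
      crossing (pos (head (par e)) - z) (pos (head (par e)) - z').
  have : \forall z' \near z, forall e, Q e z'.
    apply: (@filter_forall _ _ Q (nbhs z) _) => e; have [ve|ve] := boolP (v \in val e).
      by apply: nearW => z'; rewrite /Q ve.
    by apply: filterS (winding_near (cpar e) (avoid e ve)) => z' + _; rewrite par0 par1.
  apply: filterS => z' H.
  (* The change found in [winding_near] is a sum of one term for each end of the edge, so it is
     absorbed into the potential. *)
  by split=> -[g Hg]; exists (fun w => g w (+) crossing (pos w - z) (pos w - z')) => e ve;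
    apply: filterS2 (H e ve) (Hg e ve) => N + E; rewrite E addbACA => <-;
    rewrite ?(addKb, addbK) // addbC addbK.
have [M HM] : exists M : R, forall e s, `[0, 1]%classic s -> `|curve (par e) s| <= M.
  have : \forall M \near +oo, forall e, forall x,
      (curve (par e) @` `[0, 1]) x -> `|x| <= M.
    by apply: filter_forall => e; apply/compact_bounded/compact_curve.
  move=> /filter_ex[M HM]; exists M => e s s01; apply: (HM e); by exists s.
have [z0 Fz0 Mz0] := unbounded_set_far M nbF.
have Pz0 : P z0.
  exists (fun w => (z0.1 < - M) && upper (pos w - z0)) => e _; apply: nearW => N.
  by rewrite (winding_far N (HM e) Mz0) par0 par1.
(* Only edges avoiding [v] are concerned, so [P] is also locally constant at [pos v] and can be read
   at a nearby point of [F]. *)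
have [z [Fz HP]] := clF _ (local (pos v) avoid_v).
apply/HP; apply: (connected_invariant cF _ Fz0 Pz0 Fz) => y Fy.
by apply: local => e _; apply: avoid_F.
Qed.

Lemma outerplanar_tournament : outerplanar R G ->
  exists2 r : rel T, forall x y, x != y -> r y x = ~~ r x y &
    forall a b c d, [set a; b]%SET \in G -> [set c; d]%SET \in G ->
      [&& a != c, a != d, b != c & b != d] -> uncrossed r a b c d.
Proof.
case=> pos [arc [F [[pos_inj edgeP avoidV avoidE] [[z0 z0D FE] nbF] bdF]]].
have /choice[par parP] : forall e : I, exists p : parametrized_edge,
    [/\ {within `[0, 1], continuous (curve p)}, curve p 0 = pos (tail p),
        curve p 1 = pos (head p), val e = [set tail p; head p]%SET &
        arc (val e) = curve p @` `[0, 1]].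
  move=> [e eG] /=; have [u [v [euv [f [cf _ f0 f1 fe]]]]] := edgeP e eG.
  by exists (ParametrizedEdge u v f).
have cpar (e : I) : {within `[0, 1], continuous (curve (par e))} by case: (parP e).
have par0 (e : I) : curve (par e) 0 = pos (tail (par e)) by case: (parP e).
have par1 (e : I) : curve (par e) 1 = pos (head (par e)) by case: (parP e).
have parE (e : I) : val e = [set tail (par e); head (par e)]%SET by case: (parP e).
have parA (e : I) : arc (val e) = curve (par e) @` `[0, 1] by case: (parP e).
have off v (e : I) : v \notin val e -> ~ (curve (par e) @` `[0, 1]) (pos v).
  move=> ve; rewrite -parA => av.
  suff : (arc_interior pos arc (val e) `&` range pos) (pos v).
    by rewrite avoidV //; exact: valP.
  split; last by exists v.
  by split=> // -[w /= we /pos_inj wv]; rewrite -wv we in ve.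
have Foff (e : I) z : F z -> ~ (curve (par e) @` `[0, 1]) z.
  rewrite FE => /connected_component_sub zD; rewrite -parA => az; apply: zD.
  by right; exists (val e) => //=; exact: valP.
have cF : connected F by rewrite FE; exact: component_connected.
have /choice[g gP] v := outer_vertex_potential cpar par0 par1 (off v) Foff cF nbF (proj1 (bdF v)).
(* Exchanging [x] and [y] negates the [upper] term and preserves the sum of the others. On disjoint
   edges, [winding_disjoint] expresses the four [upper] terms through the potentials, and everything
   cancels. *)
pose r : rel T := fun x y => upper (pos y - pos x) (+) g x y (+) g y x.
exists r.
  move=> x y xy; rewrite /r -[pos x - _]opprB upperN.
    by case: (upper _) (g x y) (g y x) => [] [] [].
  by rewrite subr_eq0; apply: contra_neq xy => /pos_inj.
have base (e e' : I) : (forall v, v \in val e -> v \notin val e') ->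
    uncrossed r (tail (par e)) (head (par e)) (tail (par e')) (head (par e')).
  move=> nin.
  have nin' v : v \in val e' -> v \notin val e by apply: contraL; exact: nin.
  have te : tail (par e) \in val e by rewrite parE !inE eqxx.
  have he : head (par e) \in val e by rewrite parE !inE eqxx orbT.
  have te' : tail (par e') \in val e' by rewrite parE !inE eqxx.
  have he' : head (par e') \in val e' by rewrite parE !inE eqxx orbT.
  have ne : val e != val e' by apply/eqP => E; have := nin _ te; rewrite -E te.
  (* Interior points of the first arc are excluded by [avoidE], its ends by [off]. *)
  have dj : curve (par e) @` `[0, 1] `&` curve (par e') @` `[0, 1] = set0.
    apply/seteqP; split=> // p [pe pe'].
    rewrite -(avoidE (val e) (val e') (valP e) (valP e') ne).
    split; last by rewrite parA.
    split; first by rewrite parA.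
    by move=> [w /= we wp]; apply: (off w e' (nin w we)); rewrite wp.
  have H1 := winding_disjoint (cpar e) (cpar e') dj.
  have H2 := gP _ _ (nin' _ te'); have H3 := gP _ _ (nin' _ he').
  have H4 := gP _ _ (nin _ te); have H5 := gP _ _ (nin _ he).
  near \oo => N.
  have : curve_winding (curve (par e)) N (curve (par e') 0) (+)
    curve_winding (curve (par e)) N (curve (par e') 1) (+)
    curve_winding (curve (par e')) N (curve (par e) 0) (+)
    curve_winding (curve (par e')) N (curve (par e) 1) =
    upper (curve (par e') 0 - curve (par e) 0) (+) upper (curve (par e') 1 - curve (par e) 0) (+)
    upper (curve (par e') 0 - curve (par e) 1) (+) upper (curve (par e') 1 - curve (par e) 1).
    by near: N.
  rewrite !par0 !par1.
  have -> : curve_winding (curve (par e)) N (pos (tail (par e'))) =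
    g (tail (par e')) (tail (par e)) (+) g (tail (par e')) (head (par e)) by near: N.
  have -> : curve_winding (curve (par e)) N (pos (head (par e'))) =
    g (head (par e')) (tail (par e)) (+) g (head (par e')) (head (par e)) by near: N.
  have -> : curve_winding (curve (par e')) N (pos (tail (par e))) =
    g (tail (par e)) (tail (par e')) (+) g (tail (par e)) (head (par e')) by near: N.
  have -> : curve_winding (curve (par e')) N (pos (head (par e))) =
    g (head (par e)) (tail (par e')) (+) g (head (par e)) (head (par e')) by near: N.
  rewrite /uncrossed /r.
  move: (upper _) (upper _) (upper _) (upper _) => u1 u2 u3 u4.
  move: (g _ _) (g _ _) (g _ _) (g _ _) (g _ _) (g _ _) (g _ _) (g _ _).
  move=> h8 h7 h6 h5 h4 h3 h2 h1 H.
  rewrite -(addbA u4) -(addbA u3) -(addbA u2) -(addbA u1).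
  rewrite (addbACA u4) (addbACA (u4 (+) u3)) (addbACA (u4 (+) u3 (+) u2)) -H.
  by case: h1 h2 h3 h4 h5 h6 h7 h8 {H} => [] [] [] [] [] [] [] [].
have ends (e : I) x y : val e = [set x; y]%SET ->
    (tail (par e) = x /\ head (par e) = y) \/ (tail (par e) = y /\ head (par e) = x).
  move=> exy; have := card_edge (valP e); rewrite parE cards2.
  have : head (par e) \in [set x; y]%SET by rewrite -exy parE !inE eqxx orbT.
  have : tail (par e) \in [set x; y]%SET by rewrite -exy parE !inE eqxx.
  by rewrite !inE => /orP[]/eqP-> /orP[]/eqP->; rewrite ?eqxx //=; [left|right].
have swapr a b c d : uncrossed r a b c d = uncrossed r a b d c.
  by rewrite /uncrossed; case: (r a c) (r a d) (r b c) (r b d) => [] [] [] [].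
move=> a b c d abG cdG /and4P[ac ad bc bd].
pose e : I := exist (fun e => e \in edges G) _ abG; pose e' : I := exist (fun e => e \in edges G) _ cdG.
have dis x : x \in val e -> x \notin val e'.
  by rewrite !inE => /orP[]/eqP->; rewrite negb_or; apply/andP.
have := base e e' dis.
(* The chosen parametrizations may reverse either edge, which does not affect [uncrossed]. *)
by case: (ends e a b erefl) => -[-> ->]; case: (ends e' c d erefl) => -[-> ->];
  rewrite ?(uncrossedC _ b a) ?(swapr _ _ d c).
Unshelve. all: end_near.
Qed.

End Outerplanar.

Local Close Scope ring_scope.
Local Close Scope classical_set_scope.

(** Given the other bounds, [hM] excludes only [k = 2], [n = 3], where a triangle with three colors
    exceeds the bound 2. *)
Theorem theorem1p2 (R : realType) (k n : nat) (hk : 2 <= k)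
  (hn : 3 * k - 3 <= n) (hM : 2 * k <= n) :
  anti_ramsey (mop R n) (matching k) <= n + 4 * k - 9.
Proof.
apply/bigmax_leqP => c /asboolP[G [col [[outer _] colG norainbow]]].
have [r rC rU] := outerplanar_tournament outer.
have kn : 2 * k <= #|'I_n| by rewrite card_ord.
move: (nat_of_ord c) (rainbow_free_colors_bound rC rU colG norainbow hk kn) => m.
by rewrite card_ord; lia.
Qed.
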